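(* Let $A_S$ be an Artin group with presentation graph $\Gamma_S$, having the parabolic intersection property and the ribbon property. Assume further that $A_S$ is even, i.e. all edge labels in $\Gamma_S$ are even. Then $A_S$ has a non-elementary acylindrical splitting arising as a visual splitting if and only if the (graph-theoretic) diameter of $\Gamma_S$ is at least $3$.
   Context: **Artin groups.** Let $\Gamma_S$ be a finite simple graph with vertex set $S$, each edge $\{u,v\}$ labelled by an integer $m_{uv}\ge 2$. The Artin group with presentation graph $\Gamma_S$ is $A_S=\langle S\mid \underbrace{uvu\cdots}_{m_{uv}}=\underbrace{vuv\cdots}_{m_{uv}},\ \{u,v\}\in E(\Gamma_S)\rangle$. For $X\subseteq S$, $\Gamma_X$ is the induced labelled subgraph, and the special subgroup $A_X$ is the subgroup generated by $X$ (it is naturally the Artin group of $\Gamma_X$, by van der Lek). A parabolic subgroup is a conjugate of a special subgroup. $A_S$ is spherical if its Coxeter group (add the relations $s^2=1$, $s\in S$) is finite. **Diameter.** The diameter of $\Gamma_S$ is the supremum of edge-path distances between vertices; it is infinite (hence at least $3$) if $\Gamma_S$ is disconnected. **Visual splittings.** A visual splitting of $A_S$ is an amalgam decomposition $A_S=A_X*_{A_Z}A_Y$ with $X,Y\subseteq S$, $X\cup Y=S$, $Z=X\cap Y$ (it exists exactly when no edge of $\Gamma_S$ joins $X\setminus Z$ to $Y\setminus Z$). **Acylindricity.** An action of a group $G$ on a simplicial tree $T$ (by simplicial isometries, without inversions) is acylindrical if there are integers $k\ge0$, $C>0$ such that the pointwise stabiliser of every edge path of length at least $k$ has at most $C$ elements.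 A splitting is a non-elementary acylindrical splitting if the action on its Bass--Serre tree is acylindrical with no global fixed point and no invariant line. **Parabolic intersection property (PIP).** $A_S$ has PIP if the intersection of any two parabolic subgroups of $A_S$ is parabolic. **Ribbon property (RP).** The Dynkin diagram $\overline\Gamma_S$ has vertex set $S$, with $u,v$ adjacent iff either $\{u,v\}\in E(\Gamma_S)$ with $m_{uv}>2$, or $\{u,v\}\notin E(\Gamma_S)$. For $X\subseteq S$, the irreducible components of $X$ are the vertex sets of the connected components of $\overline\Gamma_X$; $X_s$ (resp. $X_{as}$) is the union of those irreducible components $U$ with $A_U$ spherical (resp. non-spherical). Put $X^\perp=\{s\in S:\ \{s,t\}\in E(\Gamma_S)\text{ and } m_{st}=2\ \text{for all } t\in X\}$ (so $\emptyset^\perp=S$), and $X_{as}^\perp=(X_{as})^\perp$. If $A_U$ is spherical, $\Delta_U$ is the least common multiple of $U$ in the positive monoid $A_U^+$ with respect to left divisibility ($\Delta_\emptyset=1$). For $X,Y\subseteq S$, an element $g\in A_S$ is an elementary $(X,Y)$-ribbon if $gXg^{-1}=Y$ and there is $t\in S\setminus X$ such that the vertex set $U$ of the connected component of $\overline\Gamma_{X\cup\{t\}}$ containing $t$ generates a spherical subgroup and $g=\Delta_U^{-1}\Delta_{U\setminus\{t\}}$. Let $\operatorname{Conj}(S)$ be the groupoid whose objects are the subsets of $S$ and whose morphisms $X\to Y$ are the $g\in A_S$ with $gXg^{-1}=Y$, and let $\operatorname{Ribb}(S)$ be the smallest subgroupoid with the same objects containing all elementary ribbons; $\operatorname{Ribb}(S;X,Y)$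 is the set of its morphisms $X\to Y$. For $S'\subseteq S$, $\operatorname{Ribb}(S';\cdot,\cdot)\subseteq A_{S'}$ is the same notion for $A_{S'}$. $A_S$ has RP if for all $X,Y\subseteq S$ and $g\in A_S$: $gA_Xg^{-1}\subseteq A_Y$ if and only if $X_{as}\subseteq Y$ and $g\in A_Y\cdot\operatorname{Ribb}(X_{as}^\perp;X_s,R)$ for some $R\subseteq Y$ (with $R\subseteq X_{as}^\perp$). *)

(* Defs.v *)
(* MathComp with the classical layer of MathComp-Analysis: [set G] is used for
   arbitrary subsets of infinite groups, [{set S}] for subsets of the finite
   vertex set. *)
From HB Require Import structures.
From mathcomp Require Import all_boot all_order all_algebra.
From mathcomp Require Import mathcomp_extra boolp classical_sets functions.
From mathcomp Require Import cardinality constructive_ereal.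

Set Implicit Arguments.
Unset Strict Implicit.
Unset Printing Implicit Defensive.

Local Open Scope group_scope.

Section PresentedMonoid.
Variables (T : choiceType) (R : seq T -> seq T -> Prop).

Inductive word_cong : seq T -> seq T -> Prop :=
| word_cong_rel u v : R u v -> word_cong u v
| word_cong_refl u : word_cong u u
| word_cong_sym u v : word_cong u v -> word_cong v u
| word_cong_trans u v w : word_cong u v -> word_cong v w -> word_cong u w
| word_cong_cat u u' v v' :
    word_cong u u' -> word_cong v v' -> word_cong (u ++ v) (u' ++ v').

Definition word_congb (u v : seq T) : bool := `[< word_cong u v >].

Lemma word_congb_refl : reflexive word_congb.
Proof. by move=> u; apply/asboolP; exact: word_cong_refl. Qed.

Lemma word_congb_sym : symmetric word_congb.
Proof.
by move=> u v; apply/idP/idP => /asboolP h; apply/asboolP; exact: word_cong_sym.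
Qed.

Lemma word_congb_trans : transitive word_congb.
Proof.
by move=> v u w /asboolP h /asboolP h'; apply/asboolP; exact: word_cong_trans h h'.
Qed.

Definition word_cong_equiv :=
  EquivRel word_congb word_congb_refl word_congb_sym word_congb_trans.

Definition pres_monoid : Type := {eq_quot word_cong_equiv}%qT.

HB.instance Definition _ := Choice.on pres_monoid.
HB.instance Definition _ := Quotient.on pres_monoid.

Definition word_class (w : seq T) : pres_monoid := \pi_(pres_monoid)%qT w.

Lemma word_classP u v : word_class u = word_class v <-> word_cong u v.
Proof.
split; first by move/(@eqmodP _ word_cong_equiv)/asboolP.
by move=> h; apply/(@eqmodP _ word_cong_equiv)/asboolP.
Qed.

Lemma word_class_repr (x : pres_monoid) : word_class (repr x) = x.
Proof. exact: reprK. Qed.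

Definition pres_mul (x y : pres_monoid) : pres_monoid :=
  word_class (repr x ++ repr y).

Lemma word_class_cat u v : word_class (u ++ v) = pres_mul (word_class u) (word_class v).
Proof.
by apply/word_classP/word_cong_cat; apply/word_classP; rewrite word_class_repr.
Qed.

Lemma pres_mulA : associative pres_mul.
Proof.
move=> x y z; rewrite -(word_class_repr x) -(word_class_repr y).
by rewrite -(word_class_repr z) -!word_class_cat catA.
Qed.

Lemma pres_1mul : left_id (word_class [::]) pres_mul.
Proof. by move=> x; rewrite -{1}(word_class_repr x) -word_class_cat word_class_repr. Qed.

Lemma pres_mul1 : right_id (word_class [::]) pres_mul.
Proof.
by move=> x; rewrite -{1}(word_class_repr x) -word_class_cat cats0 word_class_repr.
Qed.

HB.instance Definition _ :=
  isMonoid.Build pres_monoid pres_mulA pres_1mul pres_mul1.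

End PresentedMonoid.

(* The group <T | u = v for all (u, v) in R>, where R relates positive words.
   It is the quotient of the monoid of words in the letters (t, false), which
   stands for t, and (t, true), which stands for t^-1. *)
Section PresentedGroup.
Variables (T : choiceType) (R : seq T -> seq T -> Prop).

Definition pos_word (w : seq T) : seq (T * bool) := [seq (t, false) | t <- w].

Inductive group_rel : seq (T * bool) -> seq (T * bool) -> Prop :=
| group_rel_rel u v : R u v -> group_rel (pos_word u) (pos_word v)
| group_rel_inv t b : group_rel [:: (t, b); (t, ~~ b)] [::].

Definition pres_group : Type := pres_monoid group_rel.

HB.instance Definition _ := Monoid.on pres_group.

Definition inv_word (w : seq (T * bool)) : seq (T * bool) :=
  rev [seq (l.1, ~~ l.2) | l <- w].

Definition pres_inv (x : pres_group) : pres_group :=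
  word_class group_rel (inv_word (repr x)).

Lemma word_cong_invr w : word_cong group_rel (w ++ inv_word w) [::].
Proof.
elim: w => [|[t b] w IH]; first exact: word_cong_refl.
rewrite /inv_word /= rev_cons -/(inv_word w) -rcons_cat -cats1 -cat1s.
apply: (@word_cong_trans _ _ _ ([:: (t, b)] ++ ([::] ++ [:: (t, ~~ b)]))).
  apply: word_cong_cat; first exact: word_cong_refl.
  by apply: word_cong_cat => //; exact: word_cong_refl.
by apply: word_cong_rel; exact: group_rel_inv.
Qed.

Lemma inv_wordK : involutive inv_word.
Proof.
move=> w; rewrite /inv_word map_rev revK -map_comp -[RHS]map_id.
by apply: eq_map => -[t b] /=; rewrite negbK.
Qed.

Lemma pres_mulV : right_inverse 1 pres_inv (fun x y : pres_group => x * y).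
Proof.
move=> x; rewrite -{1}(word_class_repr x).
rewrite -[LHS]word_class_cat.
by apply/word_classP; exact: word_cong_invr.
Qed.

Lemma pres_Vmul : left_inverse 1 pres_inv (fun x y : pres_group => x * y).
Proof.
move=> x; rewrite -{2}(word_class_repr x).
rewrite -[LHS]word_class_cat; apply/word_classP.
by rewrite -{2}(inv_wordK (repr x)); exact: word_cong_invr.
Qed.

HB.instance Definition _ := hasInv.Build pres_group pres_inv.
HB.instance Definition _ := Monoid_isGroup.Build pres_group pres_Vmul pres_mulV.

Definition pos_elt (w : seq T) : pres_group := word_class group_rel (pos_word w).

End PresentedGroup.

Record lgraph (S : finType) := LGraph {
  edge : rel S;
  label : S -> S -> nat;
  edge_sym : symmetric edge;
  edge_irr : irreflexive edge;
  label_sym : forall u v, edge u v -> label u v = label v u;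
  label_ge2 : forall u v, edge u v -> 2 <= label u v }.

Definition induced (S : finType) (Gm : lgraph S) (U : {set S}) :
    lgraph {x : S | x \in U} :=
  @LGraph _ (fun x y => edge Gm (val x) (val y))
            (fun x y => label Gm (val x) (val y))
            (fun x y => edge_sym Gm (val x) (val y))
            (fun x => edge_irr Gm (val x))
            (fun x y => @label_sym _ Gm (val x) (val y))
            (fun x y => @label_ge2 _ Gm (val x) (val y)).

Definition alt_word (T : Type) (u v : T) (n : nat) : seq T :=
  mkseq (fun i => if odd i then v else u) n.

Inductive artin_rel (S : finType) (Gm : lgraph S) : seq S -> seq S -> Prop :=
| ArtinRel u v : edge Gm u v ->
    artin_rel Gm (alt_word u v (label Gm u v)) (alt_word v u (label Gm u v)).

Inductive coxeter_rel (S : finType) (Gm : lgraph S) : seq S -> seq S -> Prop :=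
| CoxeterBraid u v : artin_rel Gm u v -> coxeter_rel Gm u v
| CoxeterSquare s : coxeter_rel Gm [:: s; s] [::].

Definition artin_group (S : finType) (Gm : lgraph S) : groupType :=
  pres_group (artin_rel Gm).
Definition artin_monoid (S : finType) (Gm : lgraph S) : monoidType :=
  pres_monoid (artin_rel Gm).
Definition coxeter_group (S : finType) (Gm : lgraph S) : groupType :=
  pres_group (coxeter_rel Gm).

Definition artin_word (S : finType) (Gm : lgraph S) (w : seq S) : artin_group Gm :=
  pos_elt (artin_rel Gm) w.
Definition artin_gen (S : finType) (Gm : lgraph S) (s : S) : artin_group Gm :=
  artin_word Gm [:: s].
Definition artin_monoid_gen (S : finType) (Gm : lgraph S) (s : S) : artin_monoid Gm :=
  word_class (artin_rel Gm) [:: s].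

Definition even_artin (S : finType) (Gm : lgraph S) : Prop :=
  forall u v, edge Gm u v -> ~~ odd (label Gm u v).

Definition has_walk (S : finType) (Gm : lgraph S) (u v : S) (n : nat) : bool :=
  [exists p : n.-tuple S, path (edge Gm) u p && (last u p == v)].

Definition graph_dist (S : finType) (Gm : lgraph S) (u v : S) : \bar int :=
  if pselect (exists n, has_walk Gm u v n) is left h
  then ((ex_minn h)%:Z%:E)%E else +oo%E.

(* S is finite, so the supremum is a maximum; the empty graph gets 0. *)
Definition diameter (S : finType) (Gm : lgraph S) : \bar int :=
  \big[maxe/0%E]_(p : S * S) graph_dist Gm p.1 p.2.

Section Subgroups.
Variable G : groupType.
Implicit Types (A B C H : set G) (g : G).

Definition is_subgroup H : Prop :=
  [/\ H 1, forall x y, H x -> H y -> H (x * y) & forall x, H x -> H x^-1].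

Definition generated A : set G := smallest is_subgroup A.

Definition lcoset_set g A : set G := [set g * a | a in A]%classic.

Definition conj_set g A : set G := [set g * a * g^-1 | a in A]%classic.

Definition morph_on (H : groupType) A (f : G -> H) : Prop :=
  forall x y, A x -> A y -> f (x * y) = f x * f y.

(* G is the amalgamated product A *_C B: the square of inclusions of C, A, B
   in G is a pushout of groups.  Homomorphisms defined on a subgroup are
   represented by functions on G that are multiplicative on the subgroup. *)
Definition is_amalgam A B C : Prop :=
  [/\ [/\ is_subgroup A, is_subgroup B & is_subgroup C],
      (C `<=` A)%classic, (C `<=` B)%classic &
      forall (H : groupType) (fA fB : G -> H),
        morph_on A fA -> morph_on B fB -> (forall x, C x -> fA x = fB x) ->
        exists! f : G -> H,
          [/\ morph_on setT f, forall x, A x -> f x = fA x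
            & forall x, B x -> f x = fB x]].

End Subgroups.

Record graph_action (G : groupType) := GraphAction {
  vertex : Type;
  adj : vertex -> vertex -> Prop;
  act : G -> vertex -> vertex;
  adj_sym : forall x y, adj x y -> adj y x;
  adj_irr : forall x, ~ adj x x;
  act1 : forall x, act 1 x = x;
  actM : forall g h x, act (g * h) x = act g (act h x);
  act_adj : forall g x y, adj x y -> adj (act g x) (act g y);
  act_no_inversion : forall g x y, adj x y -> ~ (act g x = y /\ act g y = x) }.

Section Acylindrical.
Variables (G : groupType) (T : graph_action G).

(* Edge paths p 0, ..., p n without repeated vertices; in a tree these are
   the paths without backtracking, i.e. the geodesic segments. *)
Definition edge_path (n : nat) (p : nat -> vertex T) : Prop :=
  (forall i, i < n -> adj (p i) (p i.+1)) /\
  (forall i j, i <= n -> j <= n -> p i = p j -> i = j).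

Definition path_stabiliser (n : nat) (p : nat -> vertex T) : set G :=
  [set g | forall i, i <= n -> act g (p i) = p i]%classic.

Definition acylindrical : Prop :=
  exists k C : nat, 0 < C /\
    forall n p, k <= n -> edge_path n p -> (path_stabiliser n p #<= `I_C)%card.

(* For an action without inversions, a fixed point of the geometric
   realisation exists iff some vertex is fixed. *)
Definition global_fixed_point : Prop :=
  exists x : vertex T, forall g, act g x = x.

Definition invariant_line : Prop :=
  exists l : int -> vertex T,
    [/\ injective l, forall i : int, adj (l i) (l (i + 1)%R)
      & forall g i, exists j, act g (l i) = l j].

Definition nonelementary_acylindrical : Prop :=
  [/\ acylindrical, ~ global_fixed_point & ~ invariant_line].

End Acylindrical.

Section BassSerre.
Variables (G : groupType) (A B C : set G).

Definition coset_space (H : set G) : Type :=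
  {K : set G | exists g, K = lcoset_set g H}.

Lemma lcoset_setM (g h : G) (H : set G) :
  lcoset_set g (lcoset_set h H) = lcoset_set (g * h) H.
Proof.
apply/seteqP; split=> x /=.
  by case=> y [z Hz <-] <-; exists z => //; rewrite mulgA.
by case=> z Hz <-; exists (h * z); [exists z | rewrite mulgA].
Qed.

Lemma lcoset_set1 (H : set G) : lcoset_set 1 H = H.
Proof.
apply/seteqP; split=> x /=; first by case=> y Hy <-; rewrite mul1g.
by move=> Hx; exists x => //; rewrite mul1g.
Qed.

Lemma lcoset_coset (H : set G) (g : G) (K : coset_space H) :
  exists g', lcoset_set g (sval K) = lcoset_set g' H.
Proof. by case: K => K [h Kh] /=; exists (g * h); rewrite Kh lcoset_setM. Qed.

Definition coset_act (H : set G) (g : G) (K : coset_space H) : coset_space H :=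
  exist _ (lcoset_set g (sval K)) (lcoset_coset g K).

Lemma coset_act1 H (K : coset_space H) : coset_act 1 K = K.
Proof. by case: K => K hK; apply: eq_exist; exact: lcoset_set1. Qed.

Lemma coset_actM H g h (K : coset_space H) :
  coset_act (g * h) K = coset_act g (coset_act h K).
Proof. by apply: eq_exist; rewrite /= lcoset_setM. Qed.

Definition bs_vertex : Type := (coset_space A + coset_space B)%type.

(* The edges are the left cosets of C; the coset gC joins gA to gB.  If G is
   the amalgam A *_C B, then C is the intersection of A and B, so an edge is
   determined by its endpoints and the graph is Serre's tree. *)
Definition bs_joined (a : coset_space A) (b : coset_space B) : Prop :=
  exists c : coset_space C, (sval c `<=` sval a)%classic /\ (sval c `<=` sval b)%classic.

Definition bs_adj (x y : bs_vertex) : Prop :=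
  match x, y with
  | inl a, inr b => bs_joined a b
  | inr b, inl a => bs_joined a b
  | _, _ => False
  end.

Definition bs_act (g : G) (x : bs_vertex) : bs_vertex :=
  match x with
  | inl a => inl (coset_act g a)
  | inr b => inr (coset_act g b)
  end.

Lemma bs_adj_sym x y : bs_adj x y -> bs_adj y x.
Proof. by case: x; case: y. Qed.

Lemma bs_adj_irr x : ~ bs_adj x x.
Proof. by case: x => a []. Qed.

Lemma bs_act1 x : bs_act 1 x = x.
Proof. by case: x => a /=; rewrite coset_act1. Qed.

Lemma bs_actM g h x : bs_act (g * h) x = bs_act g (bs_act h x).
Proof. by case: x => a /=; rewrite coset_actM. Qed.

Lemma bs_joined_act g a b : bs_joined a b -> bs_joined (coset_act g a) (coset_act g b).
Proof.
case=> c [ca cb]; exists (coset_act g c) => /=.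
by split; apply: image_subset.
Qed.

Lemma bs_act_adj g x y : bs_adj x y -> bs_adj (bs_act g x) (bs_act g y).
Proof. by case: x; case: y => //= a b; exact: bs_joined_act. Qed.

Lemma bs_act_no_inversion g x y :
  bs_adj x y -> ~ (bs_act g x = y /\ bs_act g y = x).
Proof. by case: x; case: y => //= a b _ []. Qed.

Definition bass_serre : graph_action G :=
  GraphAction bs_adj_sym bs_adj_irr bs_act1 bs_actM bs_act_adj
              bs_act_no_inversion.

End BassSerre.

Section Artin.
Variables (S : finType) (Gm : lgraph S).
Local Notation AS := (artin_group Gm).
Implicit Types (X Y Z U : {set S}) (g h : AS).

Definition gens X : set AS := [set artin_gen Gm s | s in [set` X]]%classic.

Definition special X : set AS := generated (gens X).

Definition parabolic (P : set AS) : Prop :=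
  exists g X, P = conj_set g (special X).

Definition PIP : Prop :=
  forall P Q : set AS, parabolic P -> parabolic Q -> parabolic (P `&` Q)%classic.

Definition visual_splitting X Y : Prop :=
  X :|: Y = [set: S] /\ is_amalgam (special X) (special Y) (special (X :&: Y)).

Definition has_acylindrical_visual_splitting : Prop :=
  exists X Y, visual_splitting X Y /\
    nonelementary_acylindrical
      (bass_serre (special X) (special Y) (special (X :&: Y))).

Definition spherical U : Prop :=
  finite_set [set: coxeter_group (induced Gm U)]%classic.

Definition dynkin : rel S := fun u v =>
  [&& u != v & (edge Gm u v && (2 < label Gm u v)) || ~~ edge Gm u v].

(* Meaningful only for x in X. *)
Definition component X (x : S) : {set S} :=
  [set y in X | connect (fun u v => [&& u \in X, v \in X & dynkin u v]) x y].

Definition components X : {set {set S}} := [set component X x | x in X].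

Definition sph_part X : {set S} :=
  \bigcup_(U in components X | `[< spherical U >]) U.

Definition asph_part X : {set S} :=
  \bigcup_(U in components X | ~~ `[< spherical U >]) U.

Definition perp X : {set S} :=
  [set s | [forall t in X, edge Gm s t && (label Gm s t == 2)]].

Definition left_divides (M : monoidType) (a b : M) : Prop := exists c, b = a * c.

Definition is_gen_lcm U (d : artin_monoid (induced Gm U)) : Prop :=
  (forall u, left_divides (artin_monoid_gen (induced Gm U) u) d) /\
  (forall m, (forall u, left_divides (artin_monoid_gen (induced Gm U) u) m) ->
     left_divides d m).

(* Delta_U is the lcm of U in the monoid A_U^+ of the induced graph, mapped to
   A_S by reading any positive word that represents it. *)
Definition is_Delta U (d : AS) : Prop :=
  exists w : seq {x : S | x \in U},
    is_gen_lcm (word_class (artin_rel (induced Gm U)) w) /\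
    d = artin_word Gm [seq val x | x <- w].

Definition conjugates_gens g X Y : Prop := conj_set g (gens X) = gens Y.

Definition elementary_ribbon (S' X Y : {set S}) g : Prop :=
  [/\ X \subset S', Y \subset S', conjugates_gens g X Y &
      exists t, [/\ t \in S', t \notin X &
        let U := component (t |: X) t in
        spherical U /\
        exists d d', [/\ is_Delta U d, is_Delta (U :\ t) d' & g = d^-1 * d']]].

(* Ribb(S'; X, Y), the subgroupoid generated by the elementary ribbons with
   all objects and letters in S'; A_{S'} is identified with special S'. *)
Inductive Ribb (S' : {set S}) : {set S} -> {set S} -> AS -> Prop :=
| Ribb_id X : X \subset S' -> Ribb S' X X 1
| Ribb_elem X Y g : elementary_ribbon S' X Y g -> Ribb S' X Y g
| Ribb_inv X Y g : Ribb S' X Y g -> Ribb S' Y X g^-1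
| Ribb_comp X Y Z g h : Ribb S' X Y g -> Ribb S' Y Z h -> Ribb S' X Z (h * g).

Definition RP : Prop :=
  forall X Y g,
    (conj_set g (special X) `<=` special Y)%classic <->
    (asph_part X \subset Y /\
     exists R : {set S},
       [/\ R \subset Y, R \subset perp (asph_part X) &
           exists a r, [/\ special Y a, Ribb (perp (asph_part X)) (sph_part X) R r
                         & g = a * r]]).

End Artin.

(* Main.v *)
(* In an even Artin group, sending one generator to an arbitrary element of a
   group and all the others to [1] extends to a homomorphism; with target the
   integers this gives exponent sums, which detect most inequalities below.

   If [X], [Y] is a visual splitting, [a] is not in [Y] and [b] is not in [X],
   then [a] and [b] are not adjacent.  If they had a common neighbour [u], then
   [u] would commute with a power of [a u] in [A_X] and a power of [b u] in
   [A_Y], hence fix arbitrarily long segments of the Bass-Serre tree.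

   Conversely, if [a] and [b] are at distance at least 3, take
   [X = S \ {a}] and [Y = S \ {b}].  By PIP a non-trivial path stabiliser
   contains a conjugate of a generator [u], and by RP the cosets fixed by [u]
   are those of elements of the special subgroup of the star of [u].  This star
   misses [a] or [b], so [u] fixes at most one coset of [A_X] or at most one
   coset of [A_Y], and paths of length 3 have trivial stabiliser.  An invariant
   line would contain all vertices, in particular the infinitely many
   neighbours [a^n A_X] of [A_Y]; this is impossible since every edge of the
   Bass-Serre graph is a bridge. *)
Require Import Defs.
From HB Require Import structures.
From mathcomp Require Import all_boot all_order all_algebra.
From mathcomp Require Import perm.
From mathcomp Require Import mathcomp_extra boolp classical_sets functions.
From mathcomp Require Import cardinality constructive_ereal.
From mathcomp Require Import zify.

Set Implicit Arguments.
Unset Strict Implicit.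
Unset Printing Implicit Defensive.

Import Order.TTheory GRing.Theory Num.Theory.

Local Open Scope group_scope.

(** * Subgroups and presented groups *)

Section GroupTheory.
Variables G : groupType.
Implicit Types (A B H : set G) (g h k x y : G).

Lemma subgroup1 H : is_subgroup H -> H 1.
Proof. by case. Qed.

Lemma subgroupM H x y : is_subgroup H -> H x -> H y -> H (x * y).
Proof. by case=> _ HM _; exact: HM. Qed.

Lemma subgroupV H x : is_subgroup H -> H x -> H x^-1.
Proof. by case=> _ _ HV; exact: HV. Qed.

Lemma subgroupX H x n : is_subgroup H -> H x -> H (x ^+ n).
Proof.
move=> sH Hx; elim: n => [|n IHn]; first exact: subgroup1 sH.
by rewrite expgS; apply: (subgroupM sH).
Qed.

Lemma is_subgroup_generated A : is_subgroup (generated A).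
Proof.
split; first by move=> H [sH _]; exact: subgroup1 sH.
  by move=> x y gx gy H sHA; apply: (subgroupM sHA.1); [exact: gx | exact: gy].
by move=> x gx H sHA; apply: (subgroupV sHA.1); exact: gx.
Qed.

Lemma generatedW A : (A `<=` generated A)%classic.
Proof. exact: sub_gen_smallest. Qed.

Lemma generated_sub A H :
  is_subgroup H -> (A `<=` H)%classic -> (generated A `<=` H)%classic.
Proof. exact: smallest_sub. Qed.

Lemma is_subgroup_unit : is_subgroup [set 1 : G]%classic.
Proof.
by split=> [|x y -> ->|x ->] //=; rewrite ?mulg1 ?invg1.
Qed.

Lemma lcoset_setP g h H : is_subgroup H ->
  lcoset_set g H = lcoset_set h H <-> H (g^-1 * h).
Proof.
move=> sH; split=> [e|Hgh].
  have : lcoset_set g H h by rewrite e; exists 1; [exact: subgroup1 sH | rewrite mulg1].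
  by case=> x Hx <-; rewrite mulKg.
have {1}-> : g = h * (g^-1 * h)^-1 by rewrite invgM invgK mulVKg.
rewrite -lcoset_setM; congr lcoset_set; apply/seteqP; split=> [_ [x Hx <-]|x Hx].
  exact: subgroupM (subgroupV sH Hgh) Hx.
by exists ((g^-1 * h) * x); [exact: subgroupM sH Hgh Hx | rewrite mulKg].
Qed.

Lemma conj_setP g H x : conj_set g H x <-> H (g^-1 * x * g).
Proof.
split=> [[y Hy <-]|Hx]; first by rewrite !mulgA mulgVK mulVg mul1g.
by exists (g^-1 * x * g) => //; rewrite !mulgA mulgV mul1g mulgK.
Qed.

Lemma mulg_expgC x y n : x * (y * x) ^+ n = (x * y) ^+ n * x.
Proof.
elim: n => [|n IHn]; first by rewrite !expg0 mulg1 mul1g.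
by rewrite !expgS -!mulgA -IHn !mulgA.
Qed.

End GroupTheory.

Lemma is_subgroup_preim (G K : groupType) (f : G -> K) (B : set K) :
  {morph f : x y / x * y} -> is_subgroup B -> is_subgroup [set x | B (f x)]%classic.
Proof.
move=> fM sB; have f1 : f 1 = 1 by apply: (@mulIg _ (f 1) (f 1) 1); rewrite -fM !mul1g.
split=> [|x y /= Bx By|x /= Bx]; first by rewrite /= f1; exact: subgroup1 sB.
  by rewrite fM; apply: (subgroupM sB).
by rewrite -(@mulg1_eq _ (f x) (f x^-1)) -?fM ?mulgV //; exact: subgroupV sB Bx.
Qed.

(** * Homomorphisms out of presented groups *)

Section PresentedGroupLift.
Variables (T : choiceType) (R : seq T -> seq T -> Prop).
Local Notation P := (pres_group R).

Lemma word_classM u v :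
  word_class (group_rel R) (u ++ v) =
  (word_class (group_rel R) u : P) * word_class (group_rel R) v.
Proof. exact: word_class_cat. Qed.

Lemma pos_elt_cat u v : pos_elt R (u ++ v) = pos_elt R u * pos_elt R v.
Proof. by rewrite /pos_elt /pos_word map_cat word_classM. Qed.

Lemma pos_elt_prod w : pos_elt R w = \prod_(t <- w) pos_elt R [:: t].
Proof.
elim: w => [|t w IHw]; first by rewrite big_nil.
by rewrite big_cons -IHw -pos_elt_cat.
Qed.

Lemma pos_elt_rel u v : R u v -> pos_elt R u = pos_elt R v.
Proof. by move=> Ruv; apply/word_classP/word_cong_rel/group_rel_rel. Qed.

Lemma word_class_letterV (t : T) :
  word_class (group_rel R) [:: (t, true)] = (pos_elt R [:: t])^-1 :> P.
Proof.
symmetry; apply: mulg1_eq; rewrite -word_classM.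
by apply/word_classP/word_cong_rel/(group_rel_inv R t false).
Qed.

Lemma pres_group_ind (H : set P) :
  is_subgroup H -> (forall t, H (pos_elt R [:: t])) -> forall x, H x.
Proof.
move=> sH Hgen x; rewrite -(word_class_repr x).
elim: (repr x) => [|[t b] w IHw]; first exact: subgroup1 sH.
rewrite -cat1s word_classM; apply: (subgroupM sH) => //.
case: b; last exact: Hgen.
by rewrite word_class_letterV; exact: subgroupV sH (Hgen t).
Qed.

Variables (K : groupType) (f : T -> K).
Hypothesis fR : forall u v, R u v -> \prod_(t <- u) f t = \prod_(t <- v) f t.

Definition word_val (w : seq (T * bool)) : K :=
  \prod_(l <- w) (if l.2 then (f l.1)^-1 else f l.1).

Lemma word_val_cong u v : word_cong (group_rel R) u v -> word_val u = word_val v.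
Proof.
elim=> {u v} [u v|u|u v _ ->|u v w _ -> _ ->|u u' v v' _ e _ e'] //.
  case=> {u v} [u v Ruv|t b]; first by rewrite /word_val !big_map; exact: fR.
  by rewrite /word_val !big_cons big_nil mulg1; case: b; rewrite /= (mulgV, mulVg).
by rewrite /word_val !big_cat -!/(word_val _) e e'.
Qed.

Definition pres_lift (x : P) : K := word_val (repr x).

Lemma pres_liftE w : pres_lift (word_class (group_rel R) w) = word_val w.
Proof. by apply: word_val_cong; apply/word_classP; exact: word_class_repr. Qed.

Lemma pres_liftM : {morph pres_lift : x y / x * y}.
Proof.
move=> x y; rewrite -(word_class_repr x) -(word_class_repr y) -word_classM.
by rewrite !pres_liftE /word_val big_cat.
Qed.

Lemma pres_lift_gen t : pres_lift (pos_elt R [:: t]) = f t.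
Proof. by rewrite pres_liftE /word_val big_cons big_nil mulg1. Qed.

End PresentedGroupLift.

Lemma alt_wordSS (T : Type) (u v : T) n :
  alt_word u v n.+2 = [:: u, v & alt_word u v n].
Proof.
rewrite /alt_word /mkseq /= (iotaDl 2 0 n) -map_comp.
by congr [:: _, _ & _]; apply: eq_map => i /=; rewrite negbK.
Qed.

(** Evenness enters here: an Artin relation of label 2 k reads (u v)^k = (v u)^k. *)
Lemma prod_alt_word (T : Type) (K : groupType) (f : T -> K) u v n : ~~ odd n ->
  \prod_(t <- alt_word u v n) f t = (f u * f v) ^+ n./2.
Proof.
move=> n_even; rewrite -[in LHS](even_halfK n_even); elim: n./2 => [|k IHk].
  by rewrite big_nil.
by rewrite doubleS alt_wordSS !big_cons IHk mulgA expgS.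
Qed.

(** * Even Artin groups *)

Section EvenArtin.
Variables (S : finType) (Gm : lgraph S).
Local Notation AS := (artin_group Gm).
Local Notation gen := (artin_gen Gm).
Local Notation sp := (@special S Gm).
Implicit Types (X Y U : {set S}) (g h x y : AS).

Lemma is_subgroup_special X : is_subgroup (sp X).
Proof. exact: is_subgroup_generated. Qed.
Hint Resolve is_subgroup_special : core.

Lemma special1 X : sp X 1.
Proof. exact: subgroup1 (is_subgroup_special X). Qed.

Lemma specialM X x y : sp X x -> sp X y -> sp X (x * y).
Proof. exact: subgroupM (is_subgroup_special X). Qed.

Lemma specialV X x : sp X x -> sp X x^-1.
Proof. exact: subgroupV (is_subgroup_special X). Qed.

Lemma specialX X x n : sp X x -> sp X (x ^+ n).
Proof. exact: subgroupX (is_subgroup_special X). Qed.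

Lemma special_gen X s : s \in X -> sp X (gen s).
Proof. by move=> Xs; apply: generatedW; exists s. Qed.

Lemma special_sub_subgroup X (H : set AS) :
  is_subgroup H -> (forall s, s \in X -> H (gen s)) -> (sp X `<=` H)%classic.
Proof. by move=> sH HX; apply: generated_sub => // _ [s Xs <-]; exact: HX. Qed.

Lemma special_subset X Y : X \subset Y -> (sp X `<=` sp Y)%classic.
Proof.
by move=> /fintype.subsetP XY; apply: special_sub_subgroup => // s /XY; exact: special_gen.
Qed.

Lemma special_setT x : sp [set: S] x.
Proof. by apply: pres_group_ind x => // s; apply: special_gen; rewrite inE. Qed.

Lemma special_set0 x : sp finset.set0 x -> x = 1.
Proof.
apply: (special_sub_subgroup (is_subgroup_unit AS)) => s.
by rewrite inE.
Qed.

Lemma special_word X w : {subset w <= X} -> sp X (artin_word Gm w).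
Proof.
move=> wX; rewrite /artin_word pos_elt_prod big_seq.
apply: big_rec => [|s x /wX Xs Hx]; first exact: special1.
by apply: specialM => //; exact: special_gen.
Qed.

Hypothesis heven : even_artin Gm.

Lemma even_artin_rel u v : edge Gm u v ->
  (gen u * gen v) ^+ (label Gm u v)./2 = (gen v * gen u) ^+ (label Gm u v)./2.
Proof.
move=> uv; rewrite -!(prod_alt_word _ _ _ (heven uv)) -!pos_elt_prod.
exact/pos_elt_rel/ArtinRel.
Qed.

Lemma label_half_gt0 u v : edge Gm u v -> 0 < (label Gm u v)./2.
Proof. by move/label_ge2; case: label => [|[]]. Qed.

(** Moving v across (u v)^k turns it into (v u)^k, which the relation identifies with (u v)^k. *)
Lemma commute_gen u v : edge Gm u v ->
  commute (gen v) ((gen u * gen v) ^+ (label Gm u v)./2).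
Proof. by move=> uv; rewrite /commute mulg_expgC even_artin_rel. Qed.

Section EvenHom.
Variables (K : groupType) (s : S) (k : K).

Definition gen_hom : AS -> K := pres_lift (fun t => if t == s then k else 1).

(** An edge joins distinct vertices, so at most one of them is sent to [k], and both sides become
    the same power of [k] or of 1. *)
Lemma gen_hom_rel u v : artin_rel Gm u v ->
  \prod_(t <- u) (if t == s then k else 1) = \prod_(t <- v) (if t == s then k else 1).
Proof.
case=> {}u {}v uv; rewrite !prod_alt_word ?heven //.
have: u != v by apply: contraTneq uv => ->; rewrite edge_irr.
by case: (eqVneq u s) => [->|_]; case: (eqVneq v s) => [->|_]; rewrite ?eqxx ?mulg1 ?mul1g.
Qed.

Lemma gen_homM : {morph gen_hom : x y / x * y}.
Proof. exact: (pres_liftM gen_hom_rel). Qed.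

Lemma gen_hom_gen t : gen_hom (gen t) = if t == s then k else 1.
Proof. exact: (pres_lift_gen gen_hom_rel). Qed.

Lemma gen_hom_special X x : s \notin X -> sp X x -> gen_hom x = 1.
Proof.
move=> Xs; apply: (special_sub_subgroup (is_subgroup_preim gen_homM (is_subgroup_unit K))).
by move=> t Xt /=; rewrite gen_hom_gen; case: eqP Xs => // <-; rewrite Xt.
Qed.

End EvenHom.

(** [Algebra.to_multiplicative] writes the additive group of integers multiplicatively, so that it
    can be the target of [gen_hom]. *)
Definition expsum (s : S) : AS -> int :=
  gen_hom s (1%R : Algebra.to_multiplicative int).

Lemma expsumM s x y : expsum s (x * y) = (expsum s x + expsum s y)%R.
Proof. exact: (@gen_homM (Algebra.to_multiplicative int) s 1%R). Qed.

Lemma expsum1 s : expsum s 1 = 0%R.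
Proof. by apply: (@addrI _ (expsum s 1)); rewrite -expsumM mulg1 addr0. Qed.

Lemma expsumV s x : expsum s x^-1 = (- expsum s x)%R.
Proof. by apply: (@addrI _ (expsum s x)); rewrite -expsumM mulgV expsum1 subrr. Qed.

Lemma expsumX s x n : expsum s (x ^+ n) = (expsum s x *+ n)%R.
Proof.
by elim: n => [|n IHn]; rewrite ?expsum1 // expgS expsumM IHn mulrS.
Qed.

Lemma expsum_gen s t : expsum s (gen t) = (t == s).
Proof. by rewrite /expsum gen_hom_gen; case: eqP. Qed.

Lemma expsum_special s X x : s \notin X -> sp X x -> expsum s x = 0%R.
Proof. exact: (@gen_hom_special (Algebra.to_multiplicative int) s 1%R). Qed.

Definition expsumE := (expsumM, expsumV, expsumX, expsum1, expsum_gen).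

End EvenArtin.

(** * Distance at least three *)

Section Distance.
Variables (S : finType) (Gm : lgraph S).
Implicit Types a b u : S.

Lemma has_walk0 a b : has_walk Gm a b 0 = (a == b).
Proof.
apply/existsP/idP => [[p]|ab]; first by rewrite (tuple0 p).
by exists [tuple].
Qed.

Lemma has_walk1 a b : has_walk Gm a b 1 = edge Gm a b.
Proof.
apply/existsP/idP => [[p]|ab]; last by exists [tuple b]; rewrite /= ab eqxx.
by case/tupleP: p => u p; rewrite (tuple0 p) /= andbT => /andP[au /eqP <-].
Qed.

Lemma has_walk2 a b :
  has_walk Gm a b 2 = [exists u, edge Gm a u && edge Gm u b].
Proof.
apply/existsP/existsP => [[p]|[u /andP[au ub]]]; last first.
  by exists [tuple u; b]; rewrite /= au ub eqxx.
case/tupleP: p => u p; case/tupleP: p => v p; rewrite (tuple0 p) /= andbT.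
by case/andP=> /andP[au uv] /eqP <-; exists u; rewrite au.
Qed.

(** Excluding walks of length 0, 1 and 2 treats finite and infinite distances alike. *)
Definition far a b :=
  [&& a != b, ~~ edge Gm a b & ~~ [exists u, edge Gm a u && edge Gm u b]].

Lemma graph_dist_ge3 a b : (3%:E <= graph_dist Gm a b)%E <-> far a b.
Proof.
rewrite /far -has_walk0 -has_walk1 -has_walk2 /graph_dist.
case: pselect => [h|h] /=; last first.
  rewrite leey; split=> // _.
  by apply/and3P; split; apply/negP => w; apply: h; eexists; exact: w.
rewrite lee_fin; case: ex_minnP => m wm m_min; split.
  move=> m3; apply/and3P; split; apply/negP => /m_min; lia.
case/and3P => w0 w1 w2; case: m wm {m_min} => [|[|[|m]]] wm; last by lia.
- by rewrite wm in w0.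
- by rewrite wm in w1.
- by rewrite wm in w2.
Qed.

Lemma diameter_ge3 : (3%:E <= diameter Gm)%E <-> exists a b, far a b.
Proof.
rewrite /diameter; split=> [/bigmax_geP[|[[a b] _ /graph_dist_ge3 ab]]|[a [b ab]]].
(* The default value 0 of the maximum is below 3, so some pair of vertices must reach the bound. *)
- by rewrite lee_fin.
- by exists a, b.
- by apply/bigmax_geP; right; exists (a, b) => //; apply/graph_dist_ge3.
Qed.

End Distance.

(** * Ribbons in even Artin groups *)

Section Ribbons.
Variables (S : finType) (Gm : lgraph S).
Local Notation AS := (artin_group Gm).
Local Notation gen := (artin_gen Gm).
Local Notation sp := (@special S Gm).
Implicit Types (X Y U : {set S}) (g h x y : AS).

Definition star (u : S) : {set S} := [set s | (s == u) || edge Gm s u].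

Lemma component_sub X s : component Gm X s \subset X.
Proof. by apply/fintype.subsetP => y; rewrite inE => /andP[]. Qed.

Lemma component_id X s : s \in X -> s \in component Gm X s.
Proof. by move=> Xs; rewrite inE Xs connect0. Qed.

Lemma part_cover X : X \subset sph_part Gm X :|: asph_part Gm X.
Proof.
apply/fintype.subsetP => s Xs; rewrite inE; apply/orP.
case: (boolP `[< spherical Gm (component Gm X s) >]) => hs; [left|right];
by apply/bigcupP; exists (component Gm X s); rewrite ?component_id // hs andbT;
apply: imset_f.
Qed.

Lemma sph_part_sub X : sph_part Gm X \subset X.
Proof.
by apply/bigcupsP => U /andP[/imsetP[s _ ->] _]; exact: component_sub.
Qed.

Lemma special_Delta U d : is_Delta U d -> sp U d.
Proof.
by case=> w [_ ->]; apply: special_word => _ /mapP[s _ ->]; exact: valP.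
Qed.

(** Without edges in [U] the monoid is free: congruent words are equal, and a common multiple of [s]
    and [t] would begin with both letters. *)
Lemma no_gen_lcm U (d : artin_monoid (induced Gm U)) s t :
  s \in U -> t \in U -> s != t -> {in U &, forall u v, ~~ edge Gm u v} ->
  ~ is_gen_lcm d.
Proof.
move=> Us Ut st noedge [hd _].
have cong_eq v w : word_cong (artin_rel (induced Gm U)) v w -> v = w.
  elim=> {v w} [v w|v|v w _ ->|v w z _ -> _ ->|v v' w w' _ -> _ ->] //.
  by case=> {}v {}w /=; rewrite (negPf (noedge _ _ (valP v) (valP w))).
have [c dc] := hd (exist _ s Us); have [c' dc'] := hd (exist _ t Ut).
suff /cong_eq[] : word_cong (artin_rel (induced Gm U))
    ([:: exist _ s Us] ++ repr c) ([:: exist _ t Ut] ++ repr c').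
  by move=> /eqP; rewrite (negPf st).
by apply/word_classP; rewrite !word_class_cat !word_class_repr -[LHS]dc -[RHS]dc'.
Qed.

Lemma special_elementary_ribbon (S' X Y : {set S}) g :
  elementary_ribbon S' X Y g -> sp S' g.
Proof.
case=> XS' _ _ [t [tS' _ /= [_ [d [d' [/special_Delta dU /special_Delta d'U ->]]]]]].
have US' : component Gm (t |: X) t \subset S'.
  by apply: fintype.subset_trans (component_sub _ _) _; rewrite finset.subUset finset.sub1set tS'.
apply: specialM; first by apply: specialV; exact: special_subset US' _ dU.
by apply: special_subset d'U; apply: fintype.subset_trans US'; exact: finset.subD1set.
Qed.

Lemma special_Ribb (S' X Y : {set S}) g : Ribb S' X Y g -> sp S' g.
Proof.
elim=> {X Y g} [X _|X Y g|X Y g _ Hg|X Y Z g h _ Hg _ Hh].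
- exact: special1.
- exact: special_elementary_ribbon.
- exact: specialV.
- exact: specialM.
Qed.

(* If [t] is not adjacent to [u], then [t] and [u] have no common multiple in
   the positive monoid, so that no ribbon adjoins [t] to [{u}]. *)
Lemma elementary_ribbon_star S' (u : S) Y g :
  elementary_ribbon S' [set u] Y g -> sp (star u) g.
Proof.
case=> _ _ _ [t [_ tu /= [_ [d [d' [dU d'U ->]]]]]]; rewrite !inE in tu.
have [tu_edge|tu_nedge] := boolP (edge Gm t u).
  have Ust : component Gm [set t; u] t \subset star u.
    apply: fintype.subset_trans (component_sub _ _) _.
    by rewrite finset.subUset !finset.sub1set !inE eqxx tu_edge orbT.
  apply: specialM; first by apply: specialV; exact: special_subset Ust _ (special_Delta dU).
  apply: special_subset (special_Delta d'U).
  by apply: fintype.subset_trans Ust; exact: finset.subD1set.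
(* Vertices that are not adjacent in the graph are joined in the Dynkin diagram, so the component of
   [t] contains [u]. *)
have Ut : t \in component Gm [set t; u] t by rewrite component_id // !inE eqxx.
have Uu : u \in component Gm [set t; u] t.
  rewrite !inE eqxx orbT connect1 // !inE !eqxx orbT /=.
  by rewrite /dynkin tu tu_nedge orbT.
have [w [lcm_w _]] := dU; case: (no_gen_lcm Ut Uu tu _ lcm_w).
move=> v v' /(fintype.subsetP (component_sub _ _)) + /(fintype.subsetP (component_sub _ _)).
by rewrite !inE => /orP[]/eqP-> /orP[]/eqP->; rewrite ?edge_irr // edge_sym.
Qed.

Hypothesis heven : even_artin Gm.

(** Exponent sums are invariant under conjugation, so distinct generators are never conjugate. *)
Lemma conjugates_gens_eq g X Y : conjugates_gens g X Y -> X = Y.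
Proof.
move=> gXY; have inv_gen s t : g * gen s * g^-1 = gen t -> s = t.
  move/(congr1 (expsum t)); rewrite !(expsumE heven) eqxx.
  by rewrite addrAC subrr add0r; case: eqP.
apply/setP => s; apply/idP/idP => [Xs|Ys].
  have : @gens S Gm Y (g * gen s * g^-1) by rewrite -gXY; exists (gen s) => //; exists s.
  by case=> t Yt /esym/inv_gen ->.
have : conj_set g (@gens S Gm X) (gen s) by rewrite gXY; exists s.
by case=> _ [t Xt <-] /inv_gen <-.
Qed.

Lemma Ribb_eq S' X Y g : @Ribb S Gm S' X Y g -> X = Y.
Proof.
by elim=> {X Y g} [//|X Y g [_ _ /conjugates_gens_eq]|//|X Y Z g h _ -> _ ->].
Qed.

(** By [Ribb_eq] all objects met along the ribbon are the singleton of [u], so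
    [elementary_ribbon_star] applies to each factor. *)
Lemma Ribb_star S' (u : S) X Y g :
  @Ribb S Gm S' X Y g -> X = [set u] -> sp (star u) g.
Proof.
elim=> {X Y g} [X _ _|X Y g + Xu|X Y g gXY Hg Yu|X Y Z g h gXY Hg _ Hh Xu].
- exact: special1.
- by rewrite Xu; exact: elementary_ribbon_star.
- by apply: specialV; apply: Hg; rewrite (Ribb_eq gXY).
- by apply: specialM; [apply: Hh; rewrite -(Ribb_eq gXY) | exact: Hg].
Qed.

(** RP is applied to the singleton of [u]. If [u] is in its spherical part, the ribbon starts and
    ends at this singleton and [Ribb_star] applies. Otherwise the ribbon lies in the special
    subgroup of the perp of [u], all of whose vertices are neighbours of [u]. *)
Lemma conj_gen_special u g Y : RP Gm ->
  (conj_set g (sp [set u]) `<=` sp Y)%classic ->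
  u \in Y /\ exists y c, [/\ sp Y y, sp (star u) c & g = y * c].
Proof.
move=> /[apply] -[asY [R [RY _ [y [c [Yy cR ->]]]]]].
have uR : sph_part Gm [set u] = R := Ribb_eq cR.
have /fintype.subsetP/(_ u) := part_cover [set u].
rewrite !inE eqxx => /(_ isT)/orP[u_sph|u_asph].
  split; first by apply: (fintype.subsetP RY); rewrite -uR.
  exists y, c; split=> //; apply: Ribb_star cR _; apply/eqP.
  by rewrite finset.eqEsubset sph_part_sub finset.sub1set.
split; first exact: (fintype.subsetP asY).
exists y, c; split=> //; apply: special_subset (special_Ribb cR).
apply/fintype.subsetP => s; rewrite !inE => /forallP/(_ u).
by rewrite u_asph => /andP[-> _]; rewrite orbT.
Qed.

End Ribbons.

(** * Bass-Serre graphs of amalgams *)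

Section CosetSpace.
Variables (G : groupType) (H : set G).
Hypothesis sH : is_subgroup H.
Implicit Types (g h k : G) (K : coset_space H).

Definition coset_of g : coset_space H := exist _ (lcoset_set g H) (ex_intro _ g erefl).

Lemma coset_ofP K : exists g, K = coset_of g.
Proof. by case: K => K [g Kg]; exists g; exact: eq_exist. Qed.

Lemma eq_coset_of g h : coset_of g = coset_of h <-> H (g^-1 * h).
Proof.
rewrite -(lcoset_setP g h sH); split=> [/(congr1 sval)//|e].
exact: eq_exist.
Qed.

Lemma coset_act_of g h : coset_act g (coset_of h) = coset_of (g * h).
Proof. by apply: eq_exist; rewrite /= lcoset_setM. Qed.

Lemma mem_coset_of g k : sval (coset_of g) k <-> coset_of g = coset_of k.
Proof.
rewrite eq_coset_of; split=> [[h Hh <-]|Hgk]; first by rewrite mulKg.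
by exists (g^-1 * k) => //; rewrite mulVKg.
Qed.

Lemma coset_act_fix g h : coset_act g (coset_of h) = coset_of h <-> conj_set h H g.
Proof.
rewrite coset_act_of conj_setP; split; first by move=> /esym/eq_coset_of; rewrite mulgA.
by move=> Hg; apply/esym/eq_coset_of; rewrite mulgA.
Qed.

End CosetSpace.

Section BassSerreAdjacency.
Variables (G : groupType) (A B C : set G).
Hypotheses (sA : is_subgroup A) (sB : is_subgroup B) (sC : is_subgroup C).
Hypotheses (CA : (C `<=` A)%classic) (CB : (C `<=` B)%classic).
Local Notation T := (bass_serre A B C).

(** An edge is a coset of [C]; any representative of it represents both endpoints. *)
Lemma bs_joinedP a b :
  bs_joined C a b <-> exists k, a = coset_of A k /\ b = coset_of B k.
Proof.
split=> [[c [ca cb]]|[k [-> ->]]].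
  have [k ck] := coset_ofP c; exists k; have ckk : sval c k.
    by rewrite ck; apply/(mem_coset_of sC).
  have [[g ag] [h bh]] := (coset_ofP a, coset_ofP b).
  by subst; split; [apply/(mem_coset_of sA)/ca | apply/(mem_coset_of sB)/cb].
by exists (coset_of C k); split; apply: image_subset.
Qed.

Lemma bs_adj_inl g h : A (g^-1 * h) -> bs_adj C (inl (coset_of A g)) (inr (coset_of B h)).
Proof. by move=> Agh; apply/bs_joinedP; exists h; split=> //; apply/(eq_coset_of sA). Qed.

Lemma bs_adj_inr g h : B (g^-1 * h) -> bs_adj C (inr (coset_of B g)) (inl (coset_of A h)).
Proof. by move=> Bgh; apply/bs_joinedP; exists h; split=> //; apply/(eq_coset_of sB). Qed.

End BassSerreAdjacency.

(** * Bridges and invariant lines in the Bass-Serre graph of an amalgam *)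

Section Twist.
Variable G : groupType.

(* The semidirect product of the functions [G -> bool], under exclusive or, with
   [G] acting by left translation. *)
Definition twist : Type := ((G -> bool) * G)%type.
HB.instance Definition _ := Choice.on twist.
Implicit Types p q r : twist.

Definition twist_mul p q : twist :=
  (fun x => p.1 x (+) q.1 (p.2^-1 * x), p.2 * q.2).
Definition twist_one : twist := (fun=> false, 1).
Definition twist_inv p : twist := (fun x => p.1 (p.2 * x), p.2^-1).

Lemma twist_mulA : associative twist_mul.
Proof.
move=> p q r; congr pair; last exact: mulgA.
by apply/funext => x /=; rewrite addbA invgM mulgA.
Qed.

Lemma twist_1mul : left_id twist_one twist_mul.
Proof. by case=> f g; congr pair; rewrite /= ?mul1g //; apply/funext => x; rewrite invg1 mul1g. Qed.

Lemma twist_mul1 : right_id twist_one twist_mul.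
Proof. by case=> f g; congr pair; rewrite /= ?mulg1 //; apply/funext => x; rewrite addbF. Qed.

Lemma twist_Vmul : left_inverse twist_one twist_inv twist_mul.
Proof.
by case=> f g; congr pair; rewrite /= ?mulVg //; apply/funext => x; rewrite /= invgK addbb.
Qed.

Lemma twist_mulV : right_inverse twist_one twist_inv twist_mul.
Proof.
by case=> f g; congr pair; rewrite /= ?mulgV //; apply/funext => x; rewrite /= mulVKg addbb.
Qed.

HB.instance Definition _ := hasMul.Build twist twist_mul.
HB.instance Definition _ := Magma_isSemigroup.Build twist twist_mulA.
HB.instance Definition _ := Magma_isUMagma.Build twist twist_1mul twist_mul1.
HB.instance Definition _ := hasInv.Build twist twist_inv.
HB.instance Definition _ := Monoid_isGroup.Build twist twist_Vmul twist_mulV.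
End Twist.

Section Bridge.
Variables (G : groupType) (A B C : set G).
Hypothesis amalgam : is_amalgam A B C.

(** Map [A] to [twist G] with trivial first component, and [B] with the coboundary of the indicator
    of [C]. The two maps agree on [C], and the first component of the induced homomorphism is the
    cocycle. *)
Lemma amalgam_cocycle : exists delta : G -> G -> bool,
  [/\ forall g h x, delta (g * h) x = delta g x (+) delta h (g^-1 * x),
      forall a x, A a -> delta a x = false
    & forall b x, B b -> delta b x = `[< C x >] (+) `[< C (b^-1 * x) >]].
Proof.
have [[sA sB sC] CA CB univ] := amalgam.
pose fA g : twist G := (fun=> false, g).
pose fB g : twist G := (fun x => `[< C x >] (+) `[< C (g^-1 * x) >], g).
have [//|||f [[fM fAE fBE] _]] := univ (twist G) fA fB.
- move=> g h _ _; congr pair; apply/funext => x /=; rewrite invgM mulgA.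
  by rewrite addbA -[in RHS](addbA `[< C x >]) addbb addbF.
- move=> c Cc; congr pair; apply/funext => x.
  suff -> : C x = C (c^-1 * x) by rewrite addbb.
  apply/propext; split=> [Cx|Ccx]; first exact: subgroupM sC (subgroupV sC Cc) Cx.
  by rewrite -(mulVKg c x); exact: subgroupM sC Cc Ccx.
(* The second component of [f] and the identity both extend the inclusions of [A] and [B], so they
   agree by uniqueness. *)
have f2 g : (f g).2 = g.
  have [//|//|//|i [_ i_uniq]] := univ G id id.
  rewrite -[RHS]/(id g) -(i_uniq id) //.
  rewrite -[LHS]/((fun g => (f g).2) g) -(i_uniq (fun g => (f g).2)) //.
  split=> [x y _ _|x Ax|x Bx]; first by rewrite fM.
    by rewrite fAE.
  by rewrite fBE.
exists (fun g => (f g).1); split=> [g h x|a x Aa|b x Bb].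
- by rewrite fM //= f2.
- by rewrite fAE.
- by rewrite fBE.
Qed.

(* Pushing out [A] and [B] into the semidirect product of [G] with the
   functions [G -> bool] gives a coboundary for each edge, that is, a
   two-colouring of the vertices which changes along that edge only. *)
Lemma amalgam_bridge : exists phi : G -> bs_vertex A B -> bool,
  forall x k, phi x (inl (coset_of A k)) (+) phi x (inr (coset_of B k)) =
    `[< C (k^-1 * x) >].
Proof.
have [[sA sB sC] CA CB _] := amalgam.
have [delta [deltaM deltaA deltaB]] := amalgam_cocycle.
pose rep (H : set G) (K : coset_space H) := sval (cid (coset_ofP K)).
have repE (H : set G) g : is_subgroup H -> exists2 h, H h & rep H (coset_of H g) = g * h.
  move=> sH; exists (g^-1 * rep H (coset_of H g)); last by rewrite mulVKg.
  by apply/(eq_coset_of sH); rewrite /rep; case: cid.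
(* For fixed x, [delta g x] depends only on g A, and adding the indicator of [C] at g^-1 x makes it
   depend only on g B. The two colours of an edge differ by exactly this indicator. *)
exists (fun x v => match v with
  | inl K => delta (rep A K) x
  | inr K => delta (rep B K) x (+) `[< C ((rep B K)^-1 * x) >] end) => x k.
have [a Aa ->] := repE A k sA; have [b Bb ->] := repE B k sB.
rewrite /= !deltaM (deltaA _ _ Aa) (deltaB _ _ Bb) invgM -mulgA addbF.
by case: (delta k x); do 2!case: asboolP.
Qed.

(** An invariant line contains every vertex of type [A] and the vertex [B]. Removing [B] leaves two
    rays, so two of the three neighbours [b i] A of [B] lie on the same ray; but the edge from
    either of them to [B] is a bridge. *)
Lemma no_invariant_line (b : 'I_3 -> G) : (forall i, B (b i)) ->
  (forall i j, i != j -> ~ C ((b i)^-1 * b j)) ->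
  ~ invariant_line (bass_serre A B C).
Proof.
move=> Bb bC [l [l_inj l_adj l_inv]].
have [[sA sB sC] CA CB _] := amalgam.
have [phi phiE] := amalgam_bridge.
(* Types alternate along the line, so it meets both types, and [G] acts transitively on the vertices
   of each type. *)
have onl g : exists i, l i = inl (coset_of A g).
  have [i [K lK]] : exists i K, l i = inl K.
    have := l_adj 0%R; case e0: (l 0%R) => [K|K]; first by exists 0%R, K.
    by case e1: (l (0 + 1)%R) => [K'|//]; exists (0 + 1)%R, K'.
  have [h Kh] := coset_ofP K; have [j lj] := l_inv (g * h^-1) i.
  by exists j; rewrite -lj lK /= Kh coset_act_of mulgVK.
have [i0 li0] : exists i, l i = inr (coset_of B 1).
  have [i [K lK]] : exists i K, l i = inr K.
    have := l_adj 0%R; case e0: (l 0%R) => [K|K]; last by exists 0%R, K.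
    by case e1: (l (0 + 1)%R) => [//|K']; exists (0 + 1)%R, K'.
  have [h Kh] := coset_ofP K; have [j lj] := l_inv h^-1 i.
  by exists j; rewrite -lj lK /= Kh coset_act_of mulVg.
(* For x in [B] the only edge along which the colouring [phi x] changes ends at the vertex [B]. *)
have step x u v : B x -> bs_adj C u v -> u <> inr (coset_of B 1) ->
    v <> inr (coset_of B 1) -> phi x u = phi x v.
  move=> Bx; wlog: u v / if u is inl _ then True else False.
    move=> W; case: u v => [a|b'] [a'|b''] // uv ua va; first exact: W.
    by apply/esym/W.
  case: u v => [a|//] [//|b'] _ /(bs_joinedP sA sB sC CA CB)[k [-> ->]] _ kB.
  have := phiE x k; case: asboolP => [Ckx|_]; last by case: (phi _ _); case: (phi _ _).
  case: kB; congr inr; apply/(eq_coset_of sB); rewrite mulg1.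
  rewrite -[k^-1](mulgK x); exact: subgroupM sB (CB _ Ckx) (subgroupV sB Bx).
(* Hence [phi x] is constant on each of the two rays, selected by [s]. *)
have ray x (s : bool) : B x ->
    exists c, forall i : int, i != i0 -> (i0 < i)%R = s -> phi x (l i) = c.
  move=> Bx; have neq (i : int) : i != i0 -> l i <> inr (coset_of B 1).
    by move=> ii0; rewrite -li0 => /l_inj/eqP; rewrite (negPf ii0).
  case: s.
    exists (phi x (l (i0 + 1)%R)) => i _ i0i.
    have -> : i = (i0 + 1 + Posz (absz (i - i0 - 1)%R))%R by lia.
    elim: (absz _) => [|n IHn]; first by rewrite addr0.
    rewrite -{}IHn -[n.+1]addn1 PoszD (addrA _ (Posz n)); apply/esym/step => //.
    - exact: l_adj.
    - by apply: neq; lia.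
    - by apply: neq; lia.
  exists (phi x (l (i0 - 1)%R)) => i ii0 i0i.
  have -> : i = (i0 - 1 - Posz (absz (i0 - 1 - i)%R))%R by lia.
  elim: (absz _) => [|n IHn]; first by rewrite subr0.
  rewrite -{}IHn; apply: step => //.
  - have -> : (i0 - 1 - Posz n = i0 - 1 - Posz n.+1 + 1)%R by lia.
    exact: l_adj.
  - by apply: neq; lia.
  - by apply: neq; lia.
have side (m n : 'I_3) i j : m != n -> l i = inl (coset_of A (b m)) ->
    l j = inl (coset_of A (b n)) -> (i0 < i)%R = (i0 < j)%R -> False.
  move=> mn li lj ij; have [c phic] := ray (b n) (i0 < j)%R (Bb n).
  have neq p P : l p = inl P -> p != i0.
    by move=> lp; apply/eqP => e; rewrite e li0 in lp.
  have := phic _ (neq _ _ lj) erefl; have := phic _ (neq _ _ li) ij.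
  have cosetB p : coset_of B 1 = coset_of B (b p).
    by apply/(eq_coset_of sB); rewrite invg1 mul1g.
  rewrite li lj => <-; have := phiE (b n) (b m); have := phiE (b n) (b n).
  rewrite -!cosetB mulVg; case: asboolP => [_|/(_ (subgroup1 sC))//].
  case: asboolP => [/(bC _ _ mn)//|_].
  by do 3!case: (phi _ _).
have [j lj] := boolp.choice (fun i => onl (b i)).
(* Three neighbours and two sides: the pigeonhole principle. *)
have /injectivePn[m [n mn mnE]] : ~~ injectiveb (fun m => (i0 < j m)%R).
  by apply/injectiveP => /leq_card; rewrite card_ord card_bool.
exact: side mn (lj m) (lj n) mnE.
Qed.

End Bridge.

(** * Visual splittings *)

Section MorphOn.
Variables G K : groupType.
Implicit Types (A E : set G) (f : G -> K).

Lemma morph_on1 A f : is_subgroup A -> morph_on A f -> f 1 = 1.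
Proof.
move=> sA fM; have A1 := subgroup1 sA.
by apply: (@mulIg _ (f 1) (f 1) 1); rewrite -fM // !mul1g.
Qed.

Lemma morph_onV A f x : is_subgroup A -> morph_on A f -> A x -> f x^-1 = (f x)^-1.
Proof.
move=> sA fM Ax; apply/esym/mulg1_eq.
by rewrite -fM ?mulgV ?(morph_on1 sA fM) //; exact: subgroupV sA Ax.
Qed.

Lemma morph_on_generated_eq E f f' :
  morph_on (generated E) f -> morph_on (generated E) f' ->
  (forall x, E x -> f x = f' x) -> forall x, generated E x -> f x = f' x.
Proof.
move=> fM f'M ff' x Ex; have sE := is_subgroup_generated E.
pose H := [set y | generated E y /\ f y = f' y]%classic.
suff sH : is_subgroup H.
  have EH : (E `<=` H)%classic by move=> y Ey; split; [exact: generatedW | exact: ff'].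
  by have [] := generated_sub sH EH Ex.
split=> [|y z [Ey fy] [Ez fz]|y [Ey fy]].
- by split; [exact: subgroup1 sE | rewrite (morph_on1 sE fM) (morph_on1 sE f'M)].
- by split; [exact: subgroupM sE Ey Ez | rewrite fM // f'M // fy fz].
- by split; [exact: subgroupV sE Ey | rewrite (morph_onV sE fM) // (morph_onV sE f'M) // fy].
Qed.

End MorphOn.

Lemma alt_word_sub (T : eqType) (u v : T) n : {subset alt_word u v n <= [:: u; v]}.
Proof. by move=> t /mapP[i _ ->]; rewrite !inE; case: odd; rewrite eqxx ?orbT. Qed.

(* The reflections [x |-> - x] and [x |-> 1 - x] of the integers modulo [2 k + 1]. *)
Lemma exists_noncommuting_powers k : 0 < k ->
  exists (K : groupType) (r s : K), (r * s) ^+ k != (s * r) ^+ k.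
Proof.
(* The exponent is now k + 1, and the modulus 2 k + 3 is one more than twice the exponent. *)
case: k => // k _; pose T := 'I_(k.*2.+1).+2.
have rI : injective (fun x : T => - x)%R by exact: oppr_inj.
have sI : injective (fun x : T => 1 - x)%R by move=> x y /addrI/oppr_inj.
pose r : {perm T} := perm rI; pose s : {perm T} := perm sI.
exists ({perm T} : groupType), r, s; apply/eqP => /(congr1 (fun p : {perm T} => p 0%R)).
(* Permutations compose from left to right: r s is x |-> x + 1 and s r is x |-> x - 1. *)
have rs n : ((r * s : {perm T}) ^+ n) 0%R = n%:R%R.
  elim: n => [|n IHn]; first by rewrite expg0 perm1.
  by rewrite expgSr permM IHn permM !permE opprK -natr1 addrC.
have sr n : ((s * r : {perm T}) ^+ n) 0%R = (- n%:R)%R.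
  elim: n => [|n IHn]; first by rewrite expg0 perm1 oppr0.
  by rewrite expgSr permM IHn permM !permE opprK -natr1 opprD addrC opprD.
rewrite rs sr => /eqP; rewrite -addr_eq0 -natrD => /eqP/(congr1 val).
rewrite Zp_nat /= modn_small; lia.
Qed.

Section VisualSplittings.
Variables (S : finType) (Gm : lgraph S).
Local Notation AS := (artin_group Gm).
Local Notation gen := (artin_gen Gm).
Local Notation sp := (@special S Gm).
Implicit Types (X Y U : {set S}) (g h x y : AS).

Lemma morph_on_word (K : groupType) (f : AS -> K) X (w : seq S) :
  morph_on (sp X) f -> {subset w <= X} ->
  f (artin_word Gm w) = \prod_(t <- w) f (gen t).
Proof.
move=> fM; elim: w => [|s w IHw] wX.
  by rewrite big_nil; exact: morph_on1 (is_subgroup_special Gm X) fM.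
have wX' : {subset w <= X} by move=> t wt; apply: wX; rewrite inE wt orbT.
have Xs : s \in X by apply: wX; rewrite inE eqxx.
rewrite big_cons -IHw // -fM; last 2 first.
- exact: special_gen.
- exact: special_word.
by congr f; exact: (pos_elt_cat (artin_rel Gm) [:: s]).
Qed.

(** Each defining relation involves only letters of [X] or only letters of [Y], so maps that agree
    on the intersection glue on generators; uniqueness holds because generators determine a
    homomorphism. *)
Lemma visual_amalgam X Y : X :|: Y = [set: S] ->
  (forall s t, s \notin Y -> t \notin X -> ~~ edge Gm s t) ->
  visual_splitting Gm X Y.
Proof.
move=> XY noedge; split=> //; split; first by split; exact: is_subgroup_special.
- by apply: special_subset; exact: finset.subsetIl.
- by apply: special_subset; exact: finset.subsetIr.
move=> K fA fB fAM fBM fAB.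
pose f0 s := if s \in X then fA (gen s) else fB (gen s).
have f0B s : s \in Y -> f0 s = fB (gen s).
  by move=> Ys; rewrite /f0; case: ifP => // Xs; apply: fAB; apply: special_gen; rewrite inE Xs.
have f0R u v : artin_rel Gm u v -> \prod_(t <- u) f0 t = \prod_(t <- v) f0 t.
  move=> uv; have uvE := pos_elt_rel uv.
  have f0w (Z : {set S}) (f : AS -> K) w :
      (forall s, s \in Z -> f0 s = f (gen s)) -> morph_on (sp Z) f ->
      {subset w <= Z} -> \prod_(t <- w) f0 t = f (artin_word Gm w).
    move=> f0f fM wZ; rewrite (morph_on_word fM wZ) big_seq [RHS]big_seq.
    by apply: eq_bigr => t /wZ; exact: f0f.
  have f0A s : s \in X -> f0 s = fA (gen s) by rewrite /f0 => ->.
  suff [Z [f [f0f fM uZ vZ]]] : exists (Z : {set S}) (f : AS -> K),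
      [/\ forall s, s \in Z -> f0 s = f (gen s),
      morph_on (sp Z) f, {subset u <= Z} & {subset v <= Z}].
    by rewrite (f0w Z f u) // (f0w Z f v) // /artin_word uvE.
  case: uv {uvE} => s t st.
  have sub (Z : {set S}) : s \in Z -> t \in Z -> {subset alt_word s t (label Gm s t) <= Z} /\
      {subset alt_word t s (label Gm s t) <= Z}.
    by move=> Zs Zt; split=> r /alt_word_sub; rewrite !inE => /orP[]/eqP->.
  have inXY r : (r \in X) || (r \in Y) by rewrite -finset.in_setU XY inE.
  have [/andP[Xs Xt]|nX] := boolP ((s \in X) && (t \in X)).
    by have [] := sub X Xs Xt; exists X, fA.
  suff /andP[Ys Yt] : (s \in Y) && (t \in Y) by have [] := sub Y Ys Yt; exists Y, fB.
  move: (inXY s) (inXY t) (noedge s t) (noedge t s) nX; rewrite [edge Gm t s]edge_sym st.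
  by do 4!case: (_ \in _) => //=; move=> *; intuition.
have fM : {morph pres_lift f0 : x y / x * y >-> x * y} := pres_liftM f0R.
exists (pres_lift f0); split; first split.
- by move=> x y _ _; exact: fM.
- apply: morph_on_generated_eq => // _ [s Xs <-].
  by rewrite (pres_lift_gen f0R) /f0 ifT.
- apply: morph_on_generated_eq => // _ [s Ys <-].
  by rewrite (pres_lift_gen f0R) f0B.
move=> f [f'M f'A f'B]; apply/funext => x.
apply: (@morph_on_generated_eq _ _ (gens [set: S])) (special_setT x).
- by move=> y z _ _; exact: fM.
- by move=> y z _ _; exact: f'M.
move=> _ [s _ <-]; rewrite (pres_lift_gen f0R).
have : s \in X :|: Y by rewrite XY inE.
rewrite inE => /orP[Xs|Ys].
  by rewrite /f0 Xs f'A //; exact: special_gen.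
by rewrite f0B // f'B //; exact: special_gen.
Qed.

Hypothesis heven : even_artin Gm.

(** Killing all other generators, the pushout property allows [a] and [b] to be sent to arbitrary
    elements r and s of any group; an edge would force (r s)^k = (s r)^k. *)
Lemma visual_splitting_nonadjacent X Y a b : visual_splitting Gm X Y ->
  a \notin Y -> b \notin X -> ~~ edge Gm a b.
Proof.
case=> XY [_ _ _ univ] Ya Xb; apply/negP => ab.
have [K [r [s /eqP rs]]] := exists_noncommuting_powers (label_half_gt0 ab).
have [|||f [[fM fA fB] _]] := univ K (gen_hom a r) (gen_hom b s).
- by move=> x y _ _; exact: gen_homM.
- by move=> x y _ _; exact: gen_homM.
- move=> x Zx; rewrite !(gen_hom_special heven _ _ Zx) //.
    by rewrite inE (negPf Xb).
  by rewrite inE (negPf Ya) andbF.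
have fMM : {morph f : x y / x * y} by move=> x y; exact: fM.
have fX x n : f (x ^+ n) = f x ^+ n.
  elim: n => [|n IHn]; last by rewrite !expgS fMM IHn.
  by rewrite expg0; apply: (@morph_on1 _ _ setT) => //; split.
have inXY t : (t \in X) || (t \in Y) by rewrite -finset.in_setU XY inE.
have fa : f (gen a) = r.
  rewrite fA ?gen_hom_gen ?eqxx //; apply: special_gen.
  by move: (inXY a); rewrite (negPf Ya) orbF.
have fb : f (gen b) = s.
  rewrite fB ?gen_hom_gen ?eqxx //; apply: special_gen.
  by move: (inXY b); rewrite (negPf Xb).
by apply: rs; rewrite -fa -fb -!fMM -!fX even_artin_rel.
Qed.

(* A common neighbour [u] of [a] and [b] commutes with the elements [za] of
   [A_X] and [zb] of [A_Y], so that it fixes the whole axis of [za * zb]. *)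
Lemma common_neighbour_not_acylindrical X Y a b u :
  a \in X -> a \notin Y -> b \in Y -> b \notin X -> u \in X -> u \in Y ->
  edge Gm a u -> edge Gm b u ->
  ~ acylindrical (bass_serre (sp X) (sp Y) (sp (X :&: Y))).
Proof.
move=> Xa Ya Yb Xb Xu Yu au bu [k [C [_ acyl]]].
have [sX sY] := (is_subgroup_special Gm X, is_subgroup_special Gm Y).
have sZ := is_subgroup_special Gm (X :&: Y).
have ZX : (sp (X :&: Y) `<=` sp X)%classic by apply: special_subset; exact: finset.subsetIl.
have ZY : (sp (X :&: Y) `<=` sp Y)%classic by apply: special_subset; exact: finset.subsetIr.
set ka := (label Gm a u)./2; set kb := (label Gm b u)./2.
have ka0 : 0 < ka by exact: label_half_gt0.
have kb0 : 0 < kb by exact: label_half_gt0.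
pose za := (gen a * gen u) ^+ ka; pose zb := (gen b * gen u) ^+ kb.
have Xza : sp X za by apply: specialX; apply: specialM; exact: special_gen.
have Yzb : sp Y zb by apply: specialX; apply: specialM; exact: special_gen.
pose w := za * zb.
have expsum_w n : expsum a (w ^+ n) = (ka * n)%N /\ expsum b (w ^+ n) = (kb * n)%N.
  have ua : u != a by apply: contraTneq au => ->; rewrite edge_irr.
  have ub : u != b by apply: contraTneq bu => ->; rewrite edge_irr.
  have ab : a != b by apply: contraNneq Xb => <-.
  rewrite !(expsumE heven) !eqxx [b == a]eq_sym !(negPf ua, negPf ub, negPf ab).
  by rewrite !(addr0, add0r, mul0rn) -!mulrnA !pmulrn !intz.
(* The path runs through w^n A_X, w^n za A_Y, w^(n+1) A_X; neighbours meet because [za] is in A_X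
   and [zb] in A_Y. *)
pose p n : vertex (bass_serre (sp X) (sp Y) (sp (X :&: Y))) :=
  if odd n then inr (coset_of (sp Y) (w ^+ n./2 * za))
  else inl (coset_of (sp X) (w ^+ n./2)).
(* The exponent sum of [a] vanishes on A_Y and that of [b] on A_X, while both grow with the power of
   [w]; this separates the vertices. *)
have p_path : edge_path k p.
  split=> [i _|i j _ _]; rewrite /p /=.
    rewrite uphalf_half; case: (odd i) => /=.
      apply: bs_adj_inr => //; rewrite add1n expgSr.
      by rewrite (mulgA (w ^+ i./2) za zb) mulKg.
    by apply: bs_adj_inl => //; rewrite add0n mulKg.
  have := odd_double_half i; have := odd_double_half j.
  case: (odd i); case: (odd j) => //= ej ei [] /=.
    move=> /(lcoset_setP _ _ sY).1/(expsum_special heven Ya).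
    rewrite !(expsumM heven, expsumV heven) (expsum_w _).1 (expsum_w _).1; nia.
  move=> /(lcoset_setP _ _ sX).1/(expsum_special heven Xb).
  rewrite !(expsumM heven, expsumV heven) (expsum_w _).2 (expsum_w _).2; nia.
have u_w n : commute (gen u) (w ^+ n).
  by apply/commuteX/commuteM; exact: commute_gen.
have u_stab n : path_stabiliser k p (gen u ^+ n).
  move=> i _; rewrite /p; case: (odd i) => /=; congr (_ _);
    apply/coset_act_fix => //; apply/conj_setP.
    have c : commute (gen u ^+ n) (w ^+ i./2 * za).
      by apply/commute_sym/commuteX/commute_sym/commuteM; [exact: u_w | exact: commute_gen].
    by rewrite -mulgA c mulKg; apply: specialX; exact: special_gen.
  have c : commute (gen u ^+ n) (w ^+ i./2) by apply/commute_sym/commuteX/commute_sym/u_w.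
  by rewrite -mulgA c mulKg; apply: specialX; exact: special_gen.
(* The exponent sum of [u] distinguishes its powers, so C + 1 of them lie in a stabiliser of at most
   [C] elements. *)
have pow_inj : {in `I_C.+1 &, injective (fun n => gen u ^+ n)}.
  move=> m n _ _ /(congr1 (expsum u)); rewrite !(expsumE heven) eqxx.
  by rewrite !pmulrn !intz => -[].
have := inj_card_eq pow_inj; rewrite card_eq_le => /andP[_ le_pow].
have pow_stab : ([set gen u ^+ n | n in `I_C.+1] `<=` path_stabiliser k p)%classic.
  by move=> _ [n _ <-]; exact: u_stab.
have := card_le_trans (card_le_trans le_pow (subset_card_le pow_stab))
  (acyl k p (leqnn k) p_path).
by rewrite card_le_II ltnn.
Qed.

(** * The splitting defined by two vertices at distance at least three *)

Section FarVertices.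
Variables a b : S.
Hypothesis ab_far : far Gm a b.
Local Notation X := [set~ a].
Local Notation Y := [set~ b].
Local Notation BS := (bass_serre (sp X) (sp Y) (sp (X :&: Y))).

Let sX : is_subgroup (sp X) := is_subgroup_special Gm X.
Let sY : is_subgroup (sp Y) := is_subgroup_special Gm Y.

Let ab_neq : a != b.
Proof. by case/and3P: ab_far. Qed.

Lemma far_visual_splitting : visual_splitting Gm X Y.
Proof.
case/and3P: ab_far => ab nab _; apply: visual_amalgam.
  by apply/setP => s; rewrite !inE -negb_and; apply: contraNN ab => /andP[/eqP<-].
by move=> s t; rewrite !inE !negbK => /eqP-> /eqP->; rewrite edge_sym.
Qed.

(** Conjugates of [a] have [a]-exponent sum 1, whereas A_X has only 0, so [a] fixes no coset of A_X;
    likewise [b] fixes no coset of A_Y. *)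
Lemma far_no_fixed_point : ~ global_fixed_point BS.
Proof.
have nofix (s : S) (g : AS) : ~ conj_set g (sp [set~ s]) (gen s).
  have ss : s \notin [set~ s] by rewrite !inE eqxx.
  move=> /conj_setP/(expsum_special heven ss); rewrite !(expsumE heven) eqxx; lia.
case=> -[K|K] fixK; have [g Kg] := coset_ofP K.
  apply: (nofix a g); apply/(coset_act_fix sX); rewrite -Kg.
  exact: (congr1 (fun v => if v is inl K' then K' else K) (fixK (gen a))).
apply: (nofix b g); apply/(coset_act_fix sY); rewrite -Kg.
exact: (congr1 (fun v => if v is inr K' then K' else K) (fixK (gen b))).
Qed.

Lemma far_no_invariant_line : ~ invariant_line BS.
Proof.
have [_ amalgam] := far_visual_splitting.
apply: (no_invariant_line amalgam (b := fun i => gen a ^+ i)) => [i|i j ij].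
  by apply: specialX; apply: special_gen; rewrite !inE.
have aZ : a \notin X :&: Y by rewrite !inE eqxx.
move/(expsum_special heven aZ); rewrite !(expsumE heven) eqxx => e.
by case/eqP: ij; apply: ord_inj; move: e; rewrite !pmulrn !intz; lia.
Qed.

Hypotheses (hPIP : PIP Gm) (hRP : RP Gm).

(** If [K] is g A_Z, then g^-1 h conjugates the subgroup of [u] into A_Z; by [conj_gen_special] it
    is a product of elements of A_Z and of the star subgroup, hence lies in A_Z. *)
Lemma star_fixed_coset u h (Z : {set S}) (K : coset_space (sp Z)) :
  star Gm u \subset Z ->
  (forall x, conj_set h (sp [set u]) x -> coset_act x K = K) ->
  K = coset_of (sp Z) h.
Proof.
move=> uZ fixK; have sZ := is_subgroup_special Gm Z; have [g Kg] := coset_ofP K.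
have /(conj_gen_special heven hRP)[_ [y [c [Zy uc e]]]] :
    (conj_set (g^-1 * h) (sp [set u]) `<=` sp Z)%classic.
  move=> _ [x ux <-]; have := fixK _ (ex_intro2 _ _ x ux erefl).
  rewrite Kg => /(coset_act_fix sZ _ _).1/conj_setP.
  by rewrite invgM invgK !mulgA.
rewrite Kg; apply/(eq_coset_of sZ); rewrite e.
by apply: specialM => //; exact: special_subset uZ _ uc.
Qed.

Lemma parabolic_vertex_stabiliser (v : vertex BS) :
  parabolic [set g : AS | act g v = v]%classic.
Proof.
case: v => K; have [g Kg] := coset_ofP K; [exists g, X | exists g, Y];
  apply/seteqP; split=> x /=; rewrite Kg.
- move=> /(congr1 (fun v => if v is inl K' then K' else K)) /=.
  by move/(coset_act_fix sX).
- by move=> /(coset_act_fix sX) ->.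
- move=> /(congr1 (fun v => if v is inr K' then K' else K)) /=.
  by move/(coset_act_fix sY).
- by move=> /(coset_act_fix sY) ->.
Qed.

(* Three consecutive edges contain two vertices of each type.  An element
   conjugate to [u] fixes only one coset of [A_X] or of [A_Y], according as the
   star of [u] misses [a] or [b]. *)
Lemma far_acylindrical : acylindrical BS.
Proof.
exists 3, 1%N; split=> // n p n3 [p_adj p_inj].
pose stab i := [set g : AS | act g (p i) = p i]%classic.
have stabP i : parabolic (stab i) by exact: parabolic_vertex_stabiliser.
(* Four vertices suffice, as every path considered has at least three edges. *)
pose P := (stab 0 `&` stab 1%N `&` (stab 2 `&` stab 3))%classic.
have pathP : (path_stabiliser n p `<=` P)%classic.
  by move=> g gp; do 2![split]; apply: gp; apply: leq_trans n3.
have [h [U PE]] : parabolic P by apply: hPIP; exact: hPIP.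
apply: card_le_trans (subset_card_le pathP) _.
have [U0|[u Uu]] := set_0Vmem U.
  have P1 : (P `<=` [set (1 : AS) | _ in `I_1])%classic.
    rewrite PE U0 => x /conj_setP/special_set0 e; exists 0 => //.
    by rewrite -(mulVKg h x) -[_ * x](mulgK h) e mul1g mulgV.
  exact: card_le_trans (subset_card_le P1) (card_image_le _ _).
have fixp i x : i < 4 -> conj_set h (sp [set u]) x -> act x (p i) = p i.
  move=> i4 [y uy xy]; have : P x.
    rewrite PE; exists y => //; apply: special_subset uy.
    by rewrite finset.sub1set.
  by case=> -[? ?] [? ?]; case: i i4 => [|[|[|[|]]]].
have adjp i : i < 3 -> adj (p i) (p i.+1) by move=> i3; apply: p_adj; exact: leq_trans n3.
have neqp i : i < 2 -> p i <> p i.+2.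
  by move=> i2 /p_inj; rewrite -[i.+2]addn2; lia.
(* A vertex [u] whose closed star contained both [a] and [b] would put them at distance at most
   2. *)
have [au|bu] : star Gm u \subset X \/ star Gm u \subset Y.
- have [ua|] := boolP (a \in star Gm u); last first.
    by move=> ua; left; apply/fintype.subsetP => s us; rewrite !inE; apply: contraNneq ua => <-.
  right; apply/fintype.subsetP => s us; rewrite !inE; apply: contraTneq us => ->.
  case/and3P: ab_far => ab nab /existsPn nc; move: ua; rewrite !inE.
  case: (eqVneq a u) => [<- _|_ /= au].
    by rewrite edge_sym (negPf nab) orbF eq_sym.
  rewrite negb_or; apply/andP; split; first by apply: contraNneq nab => ->.
  by have := nc u; rewrite au edge_sym.
- have onep i K : i < 4 -> p i = inl K -> K = coset_of (sp X) h.
    move=> i4 pi; apply: star_fixed_coset au _ => x /(fixp _ _ i4).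
    by rewrite pi => /(congr1 (fun v => if v is inl K' then K' else K)).
  (* Types alternate, so [p i.+2] would be a second fixed coset of A_X, different from [p i]. This
     excludes both [p 0] and [p 1], although one of them has this type. *)
  have two (i : nat) : i < 2 -> ~ exists K, p i = inl K.
    move=> i2 [K pi]; have [K' pi'] : exists K', p i.+2 = inl K'.
      have := adjp i (ltnW i2); have := adjp i.+1 i2; rewrite pi.
      by case: (p i.+1) => // c; case: (p i.+2) => // K' _ _; exists K'.
    by apply: (neqp i i2); rewrite pi pi' (onep _ _ _ pi) ?(onep _ _ _ pi') //; lia.
  have := adjp 0 isT; case p0: (p 0) => [K|K]; first by case: (two 0) => //; exists K.
  by case p1: (p 1%N) => [K'|//] _; case: (two 1%N) => //; exists K'.
- have onep i K : i < 4 -> p i = inr K -> K = coset_of (sp Y) h.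
    move=> i4 pi; apply: star_fixed_coset bu _ => x /(fixp _ _ i4).
    by rewrite pi => /(congr1 (fun v => if v is inr K' then K' else K)).
  have two (i : nat) : i < 2 -> ~ exists K, p i = inr K.
    move=> i2 [K pi]; have [K' pi'] : exists K', p i.+2 = inr K'.
      have := adjp i (ltnW i2); have := adjp i.+1 i2; rewrite pi.
      by case: (p i.+1) => // c; case: (p i.+2) => // K' _ _; exists K'.
    by apply: (neqp i i2); rewrite pi pi' (onep _ _ _ pi) ?(onep _ _ _ pi') //; lia.
  have := adjp 0 isT; case p0: (p 0) => [K|K]; last by case: (two 0) => //; exists K.
  by case p1: (p 1%N) => [//|K'] _; case: (two 1%N) => //; exists K'.
Qed.

End FarVertices.

End VisualSplittings.

Theorem corollary1p7 (S : finType) (Gm : lgraph S)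
  (hPIP : PIP Gm) (hRP : RP Gm) (heven : even_artin Gm) :
  has_acylindrical_visual_splitting Gm <-> (3%:E <= diameter Gm)%E.
Proof.
rewrite diameter_ge3; split=> [[X [Y [XY [acyl nofix _]]]]|[a [b ab]]]; last first.
  exists [set~ a], [set~ b]; split; first exact: far_visual_splitting.
  split; first exact: far_acylindrical.
    exact: far_no_fixed_point.
  exact: far_no_invariant_line.
have XYT : X :|: Y = [set: S] by case: XY.
have inXY s : (s \in X) || (s \in Y) by rewrite -finset.in_setU XYT inE.
(* If [Z] were all of [S], its single coset would be a global fixed point. *)
have proper (Z : {set S}) :
    (forall K : coset_space (special Z), ~ forall g : artin_group Gm, coset_act g K = K) ->
    exists s, s \notin Z.
  move=> nofixZ; apply/existsP; apply: contra_notT (nofixZ (coset_of (special Z) 1)).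
  rewrite negb_exists => /forallP ZT g; apply/(coset_act_fix (is_subgroup_special Gm Z)).
  apply/conj_setP; rewrite invg1 mul1g mulg1; apply: special_subset (special_setT g).
  by apply/fintype.subsetP => s _; move: (ZT s); rewrite negbK.
have [b Xb] : exists b, b \notin X.
  by apply: proper => K fixK; apply: nofix; exists (inl K) => g /=; rewrite fixK.
have [a Ya] : exists a, a \notin Y.
  by apply: proper => K fixK; apply: nofix; exists (inr K) => g /=; rewrite fixK.
have Xa : a \in X by move: (inXY a); rewrite (negPf Ya) orbF.
have Yb : b \in Y by move: (inXY b); rewrite (negPf Xb).
exists a, b; apply/and3P; split.
- by apply: contraNneq Xb => <-.
- exact: visual_splitting_nonadjacent XY Ya Xb.
(* A common neighbour lies in both [X] and [Y], since no edge crosses the splitting. *)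
apply/existsPn => u; apply/negP => /andP[au ub].
have Xu : u \in X.
  by apply: contraTT au => Xu; apply: visual_splitting_nonadjacent XY Ya Xu.
have Yu : u \in Y.
  by apply: contraTT ub => Yu; apply: visual_splitting_nonadjacent XY Yu Xb.
by apply: (common_neighbour_not_acylindrical heven Xa Ya Yb Xb Xu Yu au _ acyl); rewrite edge_sym.
Qed.
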